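(* Let $\psi$ be a regularizer on $\mathcal{Z}=\mathcal{X}\times\mathcal{Y}$ that is $1$-strongly convex with respect to the $2$-norm and continuously differentiable on the entire domain, and let $0<\eta\le\frac{1}{8P}$. Then the iterates $\boldsymbol{z}_t$ of Optimistic Online Mirror Descent with regularizer $\psi$ and step size $\eta$, started from an arbitrary point $\widehat{\boldsymbol{z}}_1=\boldsymbol{z}_0\in\mathcal{Z}$, converge to a Nash equilibrium as $t\to\infty$; that is, there is $\boldsymbol{z}_\infty\in\mathcal{Z}^*$ with $\boldsymbol{z}_t\to\boldsymbol{z}_\infty$.
   Context: Treeplexes are defined recursively: (1) every probability simplex is a treeplex; (2) a Cartesian product of finitely many treeplexes is a treeplex; (3) given treeplexes $\mathcal{Z}_1\subset\mathbb{R}^{m}$, $\mathcal{Z}_2\subset\mathbb{R}^{n}$ and $i\in\{1,\dots,m\}$, the set $\{(\boldsymbol{u},u_i\cdot\boldsymbol{v})\in\mathbb{R}^{m+n}:\boldsymbol{u}\in\mathcal{Z}_1,\boldsymbol{v}\in\mathcal{Z}_2\}$ is a treeplex. Throughout, $\mathcal{X}\subset\mathbb{R}^M$ and $\mathcal{Y}\subset\mathbb{R}^N$ are treeplexes, $\boldsymbol{G}\in[-1,1]^{M\times N}$, $P=M+N$, $\mathcal{Z}=\mathcal{X}\times\mathcal{Y}\subset\mathbb{R}^P$, $\boldsymbol{z}=(\boldsymbol{x},\boldsymbol{y})$, and $F(\boldsymbol{z})=(\boldsymbol{G}\boldsymbol{y},-\boldsymbol{G}^\top\boldsymbol{x})$;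 it is assumed that $\|F(\boldsymbol{z})\|_\infty\le 1$ for all $\boldsymbol{z}\in\mathcal{Z}$. The set of Nash equilibria is $\mathcal{Z}^*=\mathcal{X}^*\times\mathcal{Y}^*$ with $\mathcal{X}^*=\arg\min_{\boldsymbol{x}\in\mathcal{X}}\max_{\boldsymbol{y}\in\mathcal{Y}}\boldsymbol{x}^\top\boldsymbol{G}\boldsymbol{y}$ and $\mathcal{Y}^*=\arg\max_{\boldsymbol{y}\in\mathcal{Y}}\min_{\boldsymbol{x}\in\mathcal{X}}\boldsymbol{x}^\top\boldsymbol{G}\boldsymbol{y}$. A regularizer is a convex function; it is given on $\mathcal{X}$ and on $\mathcal{Y}$ and written $\psi(\boldsymbol{z})=\psi(\boldsymbol{x})+\psi(\boldsymbol{y})$. Its Bregman divergence is $D_\psi(\boldsymbol{u},\boldsymbol{v})=\psi(\boldsymbol{u})-\psi(\boldsymbol{v})-\langle\nabla\psi(\boldsymbol{v}),\boldsymbol{u}-\boldsymbol{v}\rangle$, and $\psi$ is $1$-strongly convex with respect to the $2$-norm if $D_\psi(\boldsymbol{u},\boldsymbol{v})\ge\frac12\|\boldsymbol{u}-\boldsymbol{v}\|_2^2$ for all $\boldsymbol{u},\boldsymbol{v}$ in the domain. Optimistic Online Mirror Descent with regularizer $\psi$ and step size $\eta>0$: starting from $\widehat{\boldsymbol{z}}_1=\boldsymbol{z}_0\in\mathcal{Z}$, for $t=1,2,\dots$ $$\boldsymbol{z}_t=\arg\min_{\boldsymbol{z}\in\mathcal{Z}}\{\eta\langle\boldsymbol{z},F(\boldsymbol{z}_{t-1})\rangle+D_\psi(\boldsymbol{z},\widehat{\boldsymbol{z}}_t)\},\qquad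 \widehat{\boldsymbol{z}}_{t+1}=\arg\min_{\boldsymbol{z}\in\mathcal{Z}}\{\eta\langle\boldsymbol{z},F(\boldsymbol{z}_{t})\rangle+D_\psi(\boldsymbol{z},\widehat{\boldsymbol{z}}_t)\}.$$ *)

(* Defs.v *)
From HB Require Import structures.
From mathcomp Require Import all_boot all_order all_algebra.
From mathcomp Require Import all_classical all_reals all_analysis.
Import Order.TTheory GRing.Theory Num.Theory.
Import numFieldNormedType.Exports.

Set Implicit Arguments.
Unset Strict Implicit.
Unset Printing Implicit Defensive.

Local Open Scope classical_set_scope.
Local Open Scope ring_scope.

Section Euclidean.
Variables (R : realType) (n : nat).
Implicit Types (A : set 'cV[R]_n) (u v : 'cV[R]_n).

Definition dotv u v : R := \sum_i u i 0 * v i 0.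

(* The 2-norm; the library norm `|u| on matrices is the sup norm. *)
Definition norm2 u : R := Num.sqrt (\sum_i u i 0 ^+ 2).

(* [g] is a gradient of [f] relative to [A], at every point of [A]. Relative
   differentiability is used because treeplexes have empty interior; if [f] is
   differentiable around [A], its usual gradient satisfies this. A relative
   gradient need not be unique, but on a convex set [A] the values
   [dotv (g v) (u - v)] for [u] and [v] in [A], the only ones that matter in
   [bregman], do not depend on the choice of [g]. *)
Definition is_gradient_on A (f : 'cV[R]_n -> R) (g : 'cV[R]_n -> 'cV[R]_n) :=
  forall v, A v -> forall e : R, 0 < e ->
    \forall u \near within A (nbhs v),
      `|f u - f v - dotv (g v) (u - v)| <= e * `|u - v|.

Definition continuously_differentiable_on A f g :=
  is_gradient_on A f g /\ {within A, continuous g}.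

Definition bregman (psi : 'cV[R]_n -> R) (grad : 'cV[R]_n -> 'cV[R]_n) u v : R :=
  psi u - psi v - dotv (grad v) (u - v).

Definition strongly_convex1 A psi grad :=
  forall u v, A u -> A v -> 2^-1 * norm2 (u - v) ^+ 2 <= bregman psi grad u v.

End Euclidean.

Section Optimization.
Variables (R : realType) (T : Type).

Definition argmin (A : set T) (f : T -> R) : set T :=
  [set x | A x /\ forall y, A y -> f x <= f y].

Definition argmax (A : set T) (f : T -> R) : set T :=
  [set x | A x /\ forall y, A y -> f y <= f x].

End Optimization.

(* The first constructor takes dimension n.+1 because the simplex of R^0 would
   be empty. *)
Inductive treeplex (R : realType) : forall n, set 'cV[R]_n -> Prop :=
| treeplex_simplex n :
    treeplex [set x : 'cV[R]_n.+1 | (forall i, 0 <= x i 0) /\ \sum_i x i 0 = 1]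
| treeplex_prod k (d : 'I_k -> nat) (A : forall j, set 'cV[R]_(d j)) :
    (forall j, treeplex (A j)) ->
    treeplex [set x : 'cV[R]_(\sum_j d j) | forall j, A j (submxcol x j)]
| treeplex_branch m n (A : set 'cV[R]_m) (B : set 'cV[R]_n) (i : 'I_m) :
    treeplex A -> treeplex B ->
    treeplex [set col_mx u (u i 0 *: v) | u in A & v in B].

Section Game.
Variables (R : realType) (M N : nat).
Variables (X : set 'cV[R]_M) (Y : set 'cV[R]_N) (G : 'M[R]_(M, N)).

Definition joint_set : set 'cV[R]_(M + N) :=
  [set z | X (usubmx z) /\ Y (dsubmx z)].

Definition operatorF (z : 'cV[R]_(M + N)) : 'cV[R]_(M + N) :=
  col_mx (G *m dsubmx z) (- (G^T *m usubmx z)).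

Definition payoff (x : 'cV[R]_M) (y : 'cV[R]_N) : R := dotv x (G *m y).

(* The sup and inf are a max and a min, treeplexes being compact and
   nonempty. *)
Definition nashX : set 'cV[R]_M :=
  argmin X (fun x => sup [set payoff x y | y in Y]).

Definition nashY : set 'cV[R]_N :=
  argmax Y (fun y => inf [set payoff x y | x in X]).

Definition nash : set 'cV[R]_(M + N) :=
  [set z | nashX (usubmx z) /\ nashY (dsubmx z)].

Definition joint_fun (psiX : 'cV[R]_M -> R) (psiY : 'cV[R]_N -> R)
  (z : 'cV[R]_(M + N)) : R := psiX (usubmx z) + psiY (dsubmx z).

End Game.

(* The value [zhat 0] is unused. *)
Definition oomd (R : realType) (P : nat) (Z : set 'cV[R]_P)
    (F : 'cV[R]_P -> 'cV[R]_P) (psi : 'cV[R]_P -> R)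
    (grad : 'cV[R]_P -> 'cV[R]_P) (eta : R) (z zhat : nat -> 'cV[R]_P) : Prop :=
  [/\ Z (z 0%N), zhat 1%N = z 0%N &
    forall t, (1 <= t)%N ->
      argmin Z (fun w => eta * dotv w (F (z t.-1)) + bregman psi grad w (zhat t))
        (z t) /\
      argmin Z (fun w => eta * dotv w (F (z t)) + bregman psi grad w (zhat t))
        (zhat t.+1)].

(* Main.v *)
Require Import Defs.
From HB Require Import structures.
From mathcomp Require Import all_boot all_order all_algebra.
From mathcomp Require Import all_classical all_reals all_analysis.
From mathcomp Require Import ring lra.
Import Order.TTheory GRing.Theory Num.Theory.
Import numFieldNormedType.Exports.

(* Strong convexity and the optimality of both half-steps give, for every [u] in
   [Z] and with [Phi_u] the divergence from [u] plus one eighth of the last gap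
   squared,
     [Phi_u (t+1) + c * gap_t <= Phi_u t - eta * dotv (F u) (z (t+1))],
   because [F] is linear and skew-symmetric. Averaging over [t] shows that a
   limit point of the mean iterates satisfies [0 <= dotv (F p) u] on [Z], which
   says that [p] is a saddle point. For such a [p] the function [Phi_p]
   decreases, so the gaps vanish and every limit point of the iterates is again
   a saddle point, by continuity of the gradient. Taking [p] to be one of these
   limit points, [Phi_p] tends to 0 along a subsequence, hence along the whole
   sequence, and strong convexity gives convergence to [p]. *)

Set Implicit Arguments.
Unset Strict Implicit.
Unset Printing Implicit Defensive.

Local Open Scope classical_set_scope.
Local Open Scope ring_scope.

(** * Topology of column vectors and of treeplexes *)

(** The matrix norm is a maximum over finitely many entries, so finitely many eventual bounds
    combine into one. *)
Lemma cvg_mx_coord (T : Type) (R : realType) m n (F : set_system T)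
    (FF : Filter F) (f : T -> 'M[R]_(m, n)) (l : 'M[R]_(m, n)) :
  (forall i j, f x i j @[x --> F] --> l i j) -> f x @[x --> F] --> l.
Proof.
move=> fl; apply/cvgrPdist_lt => e e0.
have : \forall x \near F, forall ij : 'I_m * 'I_n,
    `|l ij.1 ij.2 - f x ij.1 ij.2| < e.
  apply: filter_forall => -[i j] /=.
  by move/cvgrPdist_lt : (fl i j); apply.
apply: filterS => x lf.
rewrite [ltLHS]/Num.norm/= mx_normrE.
by apply/bigmax_ltP; split=> //= ij _; rewrite !mxE; exact: lf.
Qed.

Lemma continuous_mx_coord (T : topologicalType) (R : realType) m n
    (f : T -> 'M[R]_(m, n)) :
  (forall i j, continuous (fun x => f x i j)) -> continuous f.
Proof. by move=> cf x; apply: cvg_mx_coord => i j; exact: cf. Qed.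

Lemma continuous_col_mx (T : topologicalType) (R : realType) m n p
    (f : T -> 'M[R]_(m, p)) (h : T -> 'M[R]_(n, p)) :
  continuous f -> continuous h -> continuous (fun x => col_mx (f x) (h x)).
Proof.
move=> fC hC; apply: continuous_mx_coord => i j x.
case: (split_ordP i) => k ->.
  rewrite (_ : (fun _ => _) = (fun M : 'M[R]__ => M k j) \o f).
    by apply: continuous_comp; [exact: fC | exact: coord_continuous].
  by apply/funext => y; rewrite /= col_mxEu.
rewrite (_ : (fun _ => _) = (fun M : 'M[R]__ => M k j) \o h).
  by apply: continuous_comp; [exact: hC | exact: coord_continuous].
by apply/funext => y; rewrite /= col_mxEd.
Qed.

Lemma compact_unit_box (R : realType) n :
  compact [set x : 'cV[R]_n | forall i, 0 <= x i 0 <= 1].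
Proof.
have box : compact [set v : 'rV[R]_n | forall i, `[0, 1]%classic (v ord0 i)].
  apply: (@rV_compact _ n (fun=> `[0 : R, 1]%classic)) => _.
  exact: segment_compact.
have -> : [set x : 'cV[R]_n | forall i, 0 <= x i 0 <= 1] =
    trmx @` [set v : 'rV[R]_n | forall i, `[0, 1]%classic (v ord0 i)].
  apply/seteqP; split=> [x x01|_ [v v01 <-] i] /=.
    exists x^T; last exact: trmxK.
    by move=> i; rewrite mxE /= in_itv /=; exact: x01.
  by have := v01 i; rewrite /= in_itv /= mxE.
apply: continuous_compact box; apply: continuous_subspaceT.
apply: continuous_mx_coord => i j.
rewrite (_ : (fun _ => _) = fun M : 'rV[R]_n => M j i).
  exact: coord_continuous.
by apply/funext => M; rewrite mxE.
Qed.

Definition convex_subset (R : realType) n (A : set 'cV[R]_n) :=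
  forall u v (s : R), A u -> A v -> 0 <= s <= 1 -> A (u + s *: (v - u)).

(** Provides the bound behind compactness, and the nonnegativity of the branching coordinate used
    for convexity. *)
Lemma treeplex_unit_box (R : realType) n (A : set 'cV[R]_n) :
  treeplex A -> A `<=` [set x | forall i, 0 <= x i 0 <= 1].
Proof.
elim=> {n A} [n|k d A _ IH|m n A B i _ IHA _ IHB].
- move=> x [x0 x1] i; rewrite x0 /= -x1 (bigD1 i) //= lerDl.
  by apply: sumr_ge0 => j _.
- move=> x Ax i.
  have := IH (tagnat.sig1 i) _ (Ax (tagnat.sig1 i)) (tagnat.sig2 i).
  by rewrite mxE /= tagnat.sig2K.
- move=> _ [u Au [v Bv <-]] j.
  case: (split_ordP j) => l ->; rewrite ?col_mxEu ?col_mxEd; first exact: IHA.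
  rewrite mxE; have /andP[u0 u1] := IHA _ Au i; have /andP[v0 v1] := IHB _ Bv l.
  by rewrite mulr_ge0 //= mulr_ile1.
Qed.

Lemma treeplex_nonempty (R : realType) n (A : set 'cV[R]_n) :
  treeplex A -> A !=set0.
Proof.
elim=> {n A} [n|k d A _ IH|m n A B i _ [u Au] _ [v Bv]].
- exists (\col_i (i == 0)%:R); split=> [i|]; first by rewrite mxE ler0n.
  rewrite (bigD1 0) //= big1 ?addr0 ?mxE // => i /negPf i0.
  by rewrite mxE i0.
- exists (\mxcol_j projT1 (cid (IH j))) => j.
  by rewrite mxcolK; case: cid.
- by exists (col_mx u (u i 0 *: v)); exists u => //; exists v.
Qed.

(** Only branching is delicate: mixing [a i 0 *: b] with [a' i 0 *: b'] must give the mixed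
    coordinate [c] times a point of [B]. *)
Lemma treeplex_convex (R : realType) n (A : set 'cV[R]_n) :
  treeplex A -> convex_subset A.
Proof.
elim=> {n A} [n|k d A _ IH|m n A B i tA IHA _ IHB] u v s.
- move=> [u0 u1] [v0 v1] /andP[s0 s1]; split=> [j|].
    rewrite !mxE; have := u0 j; have := v0 j; nra.
  under eq_bigr do rewrite !mxE.
  by rewrite big_split /= -mulr_sumr sumrB u1 v1 subrr mulr0 addr0.
- move=> Au Av s01 j.
  suff -> : submxcol (u + s *: (v - u)) j =
      submxcol u j + s *: (submxcol v j - submxcol u j) by exact: IH.
  by apply/colP => l; rewrite !mxE.
- move=> [a Aa [b Bb <-]] [a' Aa' [b' Bb' <-]] s01.
  exists (a + s *: (a' - a)); first exact: IHA.
  have a0 : 0 <= a i 0 by have /andP[] := treeplex_unit_box tA Aa i.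
  have a'0 : 0 <= a' i 0 by have /andP[] := treeplex_unit_box tA Aa' i.
  have [s0 s1] := andP s01.
  rewrite opp_col_mx add_col_mx scale_col_mx add_col_mx !mxE.
  set c := a i 0 + _.
  have cE : c = (1 - s) * a i 0 + s * a' i 0 by rewrite /c; ring.
  have p0 : 0 <= (1 - s) * a i 0 by rewrite mulr_ge0// subr_ge0.
  have q0 : 0 <= s * a' i 0 by rewrite mulr_ge0.
  (* If [c] is 0, both of its nonnegative summands vanish and any point of [B] serves. *)
  have [c0|c0] := eqVneq c 0.
    exists b => //; congr col_mx.
    have /eqP : (1 - s) * a i 0 = 0 by lra.
    have /eqP : s * a' i 0 = 0 by lra.
    rewrite c0 scale0r => /eqP q /eqP p.
    apply/colP => j; rewrite !mxE.
    transitivity (((1 - s) * a i 0) * b j 0 + s * a' i 0 * b' j 0).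
      by rewrite p q; ring.
    by ring.
  (* The weight of [b'] is its share of [c]. *)
  exists (b + (s * a' i 0 / c) *: (b' - b)).
    apply: IHB => //; rewrite divr_ge0 ?ler_pdivrMr //; lra.
  congr col_mx; apply/colP => j; rewrite !mxE cE; field.
  by rewrite -cE.
Qed.

(** Simplexes and products are closed subsets of the unit box; a branching is a continuous image of
    a compact product. *)
Lemma treeplex_compact (R : realType) n (A : set 'cV[R]_n) :
  treeplex A -> compact A.
Proof.
elim=> {n A} [n|k d A tA IH|m n A B i tA IHA tB IHB].
- apply: subclosed_compact (treeplex_unit_box (treeplex_simplex _ n)).
    rewrite (_ : [set _ | _] =
        (\bigcap_i (fun x : 'cV[R]_n.+1 => x i 0) @^-1` [set x | 0 <= x]) `&`
        (fun x : 'cV[R]_n.+1 => \sum_i x i 0) @^-1` [set x | x = 1]).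
      apply: closedI.
        apply: closed_bigI => i _.
        have /continuous_closedP := @coord_continuous R n.+1 1 i 0.
        by apply; exact: closed_ge.
      have /continuous_closedP : continuous (fun x : 'cV[R]_n.+1 => \sum_i x i 0).
        by apply: (continuous_big add_continuous) => i _; exact: coord_continuous.
      by apply; exact: closed_eq.
    apply/seteqP; split=> x /= [x0 x1]; split=> // i; first by move=> _; exact: x0.
    exact: x0.
  exact: compact_unit_box.
- apply: subclosed_compact (treeplex_unit_box (treeplex_prod tA)).
    rewrite (_ : [set _ | _] = \bigcap_j
        (fun x : 'cV[R]_(\sum_j d j) => submxcol x j) @^-1` A j).
      apply: closed_bigI => j _.
      have /continuous_closedP :
          continuous (fun x : 'cV[R]_(\sum_j d j) => submxcol x j).
        apply: continuous_mx_coord => a b.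
        rewrite (_ : (fun _ => _) = fun x : 'cV[R]__ => x (tagnat.Rank j a) b).
          exact: coord_continuous.
        by apply/funext => x; rewrite mxE.
      by apply; exact: compact_closed (@norm_hausdorff _ _) (IH j).
    by apply/seteqP; split=> x Ax j; [move=> _|]; exact: Ax.
  exact: compact_unit_box.
- rewrite (_ : [set _ | _ in _ & _ in _] =
      (fun uv : 'cV[R]_m * 'cV[R]_n => col_mx uv.1 (uv.1 i 0 *: uv.2)) @`
      (A `*` B)).
    apply: continuous_compact (compact_setX IHA IHB).
    apply: continuous_subspaceT.
    apply: continuous_col_mx => x; first exact: cvg_fst.
    apply: cvgZ; last exact: cvg_snd.
    apply: (@cvg_comp _ _ _ fst (fun u : 'cV[R]_m => u i 0)); first exact: cvg_fst.
    exact: coord_continuous.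
  apply/seteqP; split=> [_ [u Au [v Bv <-]]|_ [[u v] [Au Bv] <-]].
    by exists (u, v).
  by exists u => //; exists v.
Qed.

(** * The inner product and its convergence properties *)

Section Dotv.
Variables (R : realType) (n : nat).
Implicit Types u v w : 'cV[R]_n.

Lemma dotvDl u v w : dotv (u + v) w = dotv u w + dotv v w.
Proof. by rewrite -big_split; apply: eq_bigr => i _; rewrite mxE mulrDl. Qed.

Lemma dotvC u v : dotv u v = dotv v u.
Proof. by apply: eq_bigr => i _; rewrite mulrC. Qed.

Lemma dotvDr u v w : dotv w (u + v) = dotv w u + dotv w v.
Proof. by rewrite dotvC dotvDl !(dotvC w). Qed.

Lemma dotvZl (s : R) u v : dotv (s *: u) v = s * dotv u v.
Proof. by rewrite mulr_sumr; apply: eq_bigr => i _; rewrite mxE mulrA. Qed.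

Lemma dotvZr (s : R) u v : dotv u (s *: v) = s * dotv u v.
Proof. by rewrite dotvC dotvZl dotvC. Qed.

Lemma dotvNl u v : dotv (- u) v = - dotv u v.
Proof. by rewrite -scaleN1r dotvZl mulN1r. Qed.

Lemma dotvNr u v : dotv u (- v) = - dotv u v.
Proof. by rewrite dotvC dotvNl dotvC. Qed.

Definition dotvE := (dotvDl, dotvDr, dotvNl, dotvNr, dotvZl, dotvZr).

Lemma dotv_ge0 u : 0 <= dotv u u.
Proof. by apply: sumr_ge0 => i _; rewrite -expr2 sqr_ge0. Qed.

Lemma norm2_sqr u : norm2 u ^+ 2 = dotv u u.
Proof.
rewrite sqr_sqrtr; last by apply: sumr_ge0 => i _; exact: sqr_ge0.
by apply: eq_bigr => i _; rewrite expr2.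
Qed.

Lemma cvg_dotv (T : Type) (F : set_system T) (FF : Filter F)
    (f g : T -> 'cV[R]_n) (a b : 'cV[R]_n) :
  f x @[x --> F] --> a -> g x @[x --> F] --> b ->
  dotv (f x) (g x) @[x --> F] --> dotv a b.
Proof.
move=> fa gb; apply: (cvg_big add_continuous) => i _.
pose coord (M : 'cV[R]_n) := M i 0.
have coordC : continuous coord by exact: coord_continuous.
by apply: cvgM; [apply: (@cvg_comp _ _ _ f coord _ _ _ fa)
               |apply: (@cvg_comp _ _ _ g coord _ _ _ gb)]; exact: coordC.
Qed.

(** Each squared coordinate is at most [dotv (f x) (f x)]. *)
Lemma cvg0_dotv (T : Type) (F : set_system T) (FF : Filter F)
    (f : T -> 'cV[R]_n) :
  dotv (f x) (f x) @[x --> F] --> 0 -> f x @[x --> F] --> (0 : 'cV[R]_n).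
Proof.
move=> f0; apply: cvg_mx_coord => i j; rewrite mxE (ord1 j).
apply/cvgr0Pnorm_lt => e e0.
have /cvgr0Pnorm_lt/(_ (e ^+ 2)) := f0.
rewrite exprn_gt0 // => /(_ isT); apply: filterS => x.
rewrite ger0_norm ?dotv_ge0 // => lt_fe.
rewrite -(@ltr_pXn2r _ 2) ?nnegrE ?normr_ge0 ?(ltW e0) //.
apply: le_lt_trans lt_fe; rewrite real_normK ?num_real //.
rewrite /dotv (bigD1 i) //= -expr2 lerDl.
by apply: sumr_ge0 => k _; rewrite -expr2 sqr_ge0.
Qed.

Lemma convex_approach u v :
  (fun k => u + harmonic k *: (v - u)) @ \oo --> u.
Proof.
rewrite [X in _ --> X](_ : u = u + 0 *: (v - u)); last by rewrite scale0r addr0.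
apply: cvgD; first exact: cvg_cst.
by apply: cvgZr_tmp; exact: cvg_harmonic.
Qed.

End Dotv.

(** * Subsequences and descent *)

(** The reindexing need not be increasing: [k <= s k] already makes it tend to infinity. *)
Lemma cvg_along (T : Type) (s : nat -> nat) (f : nat -> T) (F : set_system T) :
  (forall k, (k <= s k)%N) -> f @ \oo --> F -> (f \o s) @ \oo --> F.
Proof.
move=> sk fF A /fF [N _ NA]; exists N => // k Nk.
by apply: NA; exact: leq_trans Nk (sk k).
Qed.

(** Around a cluster point [p], [s k] is chosen as an index beyond [k] whose term is within
    [harmonic k], that is 1/(k+1), of [p]. *)
Lemma compact_seq (R : realType) n (A : set 'cV[R]_n) (w : nat -> 'cV[R]_n) :
  compact A -> (forall k, A (w k)) ->
  exists2 p, A p & exists2 s : nat -> nat,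
    (forall k, (k <= s k)%N) & (w \o s) @ \oo --> p.
Proof.
move=> cA Aw; have [|p [Ap clp]] := cA (w @ \oo) _.
  by exists 0%N => // k _; exact: Aw.
exists p => //.
have /choice[s sP] k : exists m, (k <= m)%N /\ `|p - w m| < harmonic k.
  have tail : (w @ \oo) (w @` [set m | (k <= m)%N]).
    by exists k => // m km; exists m.
  have pk : nbhs p (ball p (harmonic k)) by exact/nbhsx_ballx/harmonic_gt0.
  have [_ [[m km <-] pm]] := clp _ _ tail pk.
  by exists m; split=> //; move: pm; rewrite -ball_normE.
exists s => [k|]; first by have [] := sP k.
apply/cvgrPdist_lt => e e0.
have /cvgr0Pnorm_lt/(_ _ e0) := @cvg_harmonic R.
apply: filterS => k; apply: le_lt_trans.
by rewrite ger0_norm ?harmonic_ge0 // ltW //; have [] := sP k.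
Qed.

Lemma descent_cvg (R : realType) (Phi d : nat -> R) :
  (forall k, 0 <= Phi k) -> (forall k, 0 <= d k) ->
  (forall k, Phi k.+1 + d k <= Phi k) ->
  cvgn Phi /\ d @ \oo --> 0.
Proof.
move=> Phi0 d0 Phid.
have cPhi : cvgn Phi.
  apply: nonincreasing_is_cvgn; last by exists 0 => _ [k _ <-].
  by apply/nonincreasing_seqP => k; apply: le_trans (Phid k); rewrite lerDl.
split=> //.
apply: (@squeeze_cvgr _ _ _ _ (fun=> 0) (fun k => Phi k - Phi k.+1)).
- by apply: nearW => k; rewrite d0 lerBrDl Phid.
- exact: cvg_cst.
- rewrite -(subrr (limn Phi)); apply: cvgB => //.
  by rewrite cvg_shiftS.
Qed.

(** * Optimistic mirror descent for a skew-symmetric operator *)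

Section MirrorDescent.
Variables (R : realType) (n : nat) (Z : set 'cV[R]_n).
Variables (psi : 'cV[R]_n -> R) (g : 'cV[R]_n -> 'cV[R]_n).
Hypotheses (Zconv : convex_subset Z) (Zcomp : compact Z).
Hypotheses (gcont : {within Z, continuous g}) (psi_sc : strongly_convex1 Z psi g).

Local Notation D := (bregman psi g).
Local Notation sq u := (dotv u u).

Lemma bregman_ge u v : Z u -> Z v -> 2^-1 * sq (u - v) <= D u v.
Proof. by rewrite -norm2_sqr; exact: psi_sc. Qed.

Lemma bregman_ge0 u v : Z u -> Z v -> 0 <= D u v.
Proof.
move=> Zu Zv; apply: le_trans (bregman_ge Zu Zv).
by rewrite mulr_ge0 ?dotv_ge0.
Qed.

(** The right-hand side is the symmetrized divergence [D u v + D v u]. *)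
Lemma bregman_le u v : Z u -> Z v -> D u v <= dotv (g u - g v) (u - v).
Proof.
move=> Zu Zv; have := bregman_ge0 Zv Zu.
by rewrite /bregman !dotvE; lra.
Qed.

Lemma gradient_cvg (u : nat -> 'cV[R]_n) (p : 'cV[R]_n) :
  (forall k, Z (u k)) -> Z p -> u @ \oo --> p -> (g \o u) @ \oo --> g p.
Proof.
move=> Zu Zp up; have /subspace_continuousP/(_ p Zp) := gcont.
apply: cvg_comp => A; rewrite /within /= => /up.
by rewrite !nbhs_simpl /=; apply: filterS => k; exact.
Qed.

(* Strong convexity stands in for the directional derivative of [psi]: it gives
   [psi w_k - psi w <= dotv (g w_k) (w_k - w)] along the segment, and [g] is
   continuous. *)
Lemma mirror_step_optimality (eta : R) f c w u :
  argmin Z (fun v => eta * dotv v f + D v c) w -> Z u ->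
  0 <= eta * dotv f (u - w) + dotv (g w - g c) (u - w).
Proof.
move=> [Zw wmin] Zu.
pose w_ k := w + harmonic k *: (u - w).
have h01 k : 0 <= (harmonic k : R) <= 1.
  by rewrite harmonic_ge0 /= invf_le1 ?ltr0n // ler1n.
have Zw_ k : Z (w_ k) by exact: Zconv.
have slope k : 0 <= eta * dotv f (u - w) + dotv (g (w_ k) - g c) (u - w).
  (* Since [w_ k - w] is [harmonic k *: (u - w)], adding minimality at [w_ k] to [0 <= D w (w_ k)]
     gives the claim times [harmonic k]. *)
  rewrite -(pmulr_rge0 _ (harmonic_gt0 k)).
  have := wmin _ (Zw_ k); have := bregman_ge0 Zw (Zw_ k); rewrite /bregman /w_.
  set gk := g (_ + _); rewrite !dotvE !(dotvC w f, dotvC u f).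
  by lra.
have lim : eta * dotv f (u - w) + dotv (g (w_ k) - g c) (u - w) @[k --> \oo] -->
    eta * dotv f (u - w) + dotv (g w - g c) (u - w).
  apply: cvgD; first exact: cvg_cst.
  apply: cvg_dotv; last exact: cvg_cst.
  apply: cvgB; last exact: cvg_cst.
  by apply: gradient_cvg => //; exact: convex_approach.
by apply: (cvgr_to_ge lim); exact: nearW.
Qed.

(** Three-point identity: [dotv (g w - g c) (u - w)] equals [D u c - D u w - D w c]. *)
Lemma mirror_step_three_point (eta : R) f c w u :
  argmin Z (fun v => eta * dotv v f + D v c) w -> Z u ->
  eta * dotv f (w - u) <= D u c - D u w - D w c.
Proof.
move=> wmin Zu; have := mirror_step_optimality wmin Zu.
by rewrite /bregman !dotvE; lra.
Qed.

(** * A single optimistic step *)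

Variables (F : 'cV[R]_n -> 'cV[R]_n) (eta : R).
Hypotheses (eta_gt0 : 0 < eta) (FB : {morph F : u v / u - v}).
Hypothesis Fskew : forall u v, dotv (F u) v = - dotv (F v) u.
(** The smallness of the step size enters in this form; applied to differences, it acts as a
    Lipschitz bound on [F]. *)
Hypothesis Fbound : forall u v, eta * dotv (F u) v <= 16^-1 * (sq u + sq v).

Lemma skew_diag u : dotv (F u) u = 0.
Proof. by have := Fskew u u; lra. Qed.

(** By skew-symmetry each coordinate of [F v] is the inner product of [v] with a fixed vector, which
    gives continuity. *)
Lemma skew_cvg (u : nat -> 'cV[R]_n) (p : 'cV[R]_n) :
  u @ \oo --> p -> (F \o u) @ \oo --> F p.
Proof.
have FE v i : F v i 0 = - dotv (F (delta_mx i 0)) v.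
  rewrite -Fskew /dotv (bigD1 i) //= big1 ?mxE ?eqxx ?mulr1 ?addr0 // => j ji.
  by rewrite mxE (negPf ji) mulr0.
move=> up; apply: cvg_mx_coord => i j; rewrite (ord1 j) FE.
under eq_fun do rewrite FE.
by apply: cvgN; apply: cvg_dotv up; exact: cvg_cst.
Qed.

(* Skew-symmetry makes this the variational inequality
   [0 <= dotv (F p) (u - p)]. *)
Definition vi_solution p := Z p /\ forall u, Z u -> 0 <= dotv (F p) u.

(** The three-point bounds for [w'] against [u] and for [z'] against [w'] are added, cancelling
    [D w' c]. The prediction error costs 1/16 of [sq (z' - z) + sq (w' - z')], and strong convexity
    pays 1/2 of each gap: 7/16 is 1/2 - 1/16, and 3/8 is 1/2 - 2/16 after splitting [z' - z] at
    [c]. *)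
Lemma optimistic_step z c z' w' u : Z z -> Z c -> Z u ->
  argmin Z (fun v => eta * dotv v (F z) + D v c) z' ->
  argmin Z (fun v => eta * dotv v (F z') + D v c) w' ->
  eta * dotv (F u) z' + D u w' + 7 / 16 * sq (w' - z') + 3 / 8 * sq (z' - c)
    <= D u c + 8^-1 * sq (c - z).
Proof.
move=> Zz Zc Zu z'min w'min.
have [Zz' _] := z'min; have [Zw' _] := w'min.
have Dw'z' := bregman_ge Zw' Zz'; have Dz'c := bregman_ge Zz' Zc.
have w'step : eta * (dotv (F z') w' - dotv (F z') u) <= D u c - D u w' - D w' c.
  by rewrite -dotvNr -dotvDr; exact: mirror_step_three_point.
have z'step : eta * (dotv (F z) z' - dotv (F z) w') <=
    D w' c - D w' z' - D z' c.
  by rewrite -dotvNr -dotvDr; exact: mirror_step_three_point.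
have optimism : eta * (dotv (F z') z' - dotv (F z) z'
    - (dotv (F z') w' - dotv (F z) w')) <=
    16^-1 * (sq (z' - z) + sq (w' - z')).
  have -> : sq (w' - z') = sq (z' - w') by rewrite -opprB dotvNl dotvNr opprK.
  apply: le_trans (Fbound _ _).
  by rewrite FB !dotvE; lra.
have parallelogram : sq (z' - z) <= 2 * sq (z' - c) + 2 * sq (c - z).
  have := dotv_ge0 (z' - c - (c - z)).
  rewrite -[z' - z](subrKA c).
  move: (z' - c) (c - z) => p q; rewrite !dotvE (dotvC q p); lra.
rewrite (Fskew u); move: optimism; rewrite skew_diag; lra.
Qed.

(** The mean of [z 0], ..., [z k], in incremental form so that each step is a convex combination. *)
Fixpoint running_average (z : nat -> 'cV[R]_n) k :=
  if k is k'.+1 then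
    running_average z k' + harmonic k *: (z k - running_average z k')
  else z 0%N.

Lemma running_average_in z k :
  (forall j, Z (z j)) -> Z (running_average z k).
Proof.
move=> Zz; elim: k => [|k IH]; first exact: Zz.
by apply: Zconv => //; rewrite harmonic_ge0 /= invf_le1 ?ltr0n // ler1n.
Qed.

(** * The iterates and their Lyapunov function *)

Variables z w : nat -> 'cV[R]_n.
(** [w k] is the prox center from which both [z k.+1] and [w k.+1] are computed. *)
Hypotheses (Zz0 : Z (z 0%N)) (w0 : w 0%N = z 0%N).
Hypothesis zmin : forall k,
  argmin Z (fun v => eta * dotv v (F (z k)) + D v (w k)) (z k.+1).
Hypothesis wmin : forall k,
  argmin Z (fun v => eta * dotv v (F (z k.+1)) + D v (w k)) (w k.+1).

Lemma optimistic_z_in k : Z (z k).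
Proof. by case: k => // k; case: (zmin k). Qed.

Lemma optimistic_w_in k : Z (w k).
Proof. by case: k => [|k]; rewrite ?w0 //; case: (wmin k). Qed.

Local Notation Zz := optimistic_z_in.
Local Notation Zw := optimistic_w_in.

Definition lyapunov u k := D u (w k) + 8^-1 * sq (w k - z k).

Lemma lyapunov_ge0 u k : Z u -> 0 <= lyapunov u k.
Proof.
move=> Zu; apply: addr_ge0; first exact: bregman_ge0 (Zw k).
by rewrite mulr_ge0 ?dotv_ge0.
Qed.

(** Of the coefficient 7/16 in [optimistic_step], 1/8 goes into the next Lyapunov value and 5/16
    remains. *)
Lemma lyapunov_step u k : Z u ->
  lyapunov u k.+1 + (5 / 16 * sq (w k.+1 - z k.+1) + 3 / 8 * sq (z k.+1 - w k))
    <= lyapunov u k - eta * dotv (F u) (z k.+1).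
Proof.
move=> Zu; have := optimistic_step (Zz k) (Zw k) Zu (zmin k) (wmin k).
by rewrite /lyapunov; lra.
Qed.

(* The regret bound makes every limit point of the averaged iterates a
   solution, so no minimax theorem is needed. *)
Lemma vi_solution_exists : exists p, vi_solution p.
Proof.
(* The shift matches [lyapunov_step], which controls [F] at [z k.+1]: [a k] averages [z 1], ...,
   [z k.+1]. *)
pose a := running_average (fun k => z k.+1).
have Za k : Z (a k) by apply: running_average_in => j; exact: Zz.
have step u k : Z u -> lyapunov u k.+1 <= lyapunov u k - eta * dotv (F u) (z k.+1).
  move=> Zu; apply: le_trans (lyapunov_step k Zu).
  by rewrite lerDl addr_ge0 ?mulr_ge0 ?dotv_ge0.
have regret u k : Z u ->
    lyapunov u k.+1 + eta * (k.+1%:R * dotv (F u) (a k)) <= lyapunov u 0.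
  move=> Zu; elim: k => [|k IH]; first by have := step u 0%N Zu; rewrite mul1r; lra.
  have -> : k.+2%:R * dotv (F u) (a k.+1) =
      k.+1%:R * dotv (F u) (a k) + dotv (F u) (z k.+2).
    rewrite /a /= dotvDr dotvZr dotvDr dotvNr mulrDr mulrA divff ?pnatr_eq0 //.
    by rewrite mul1r -[k.+2%:R]natr1; ring.
  by have := step u k.+1 Zu; lra.
have [p Zp [s sk ap]] := compact_seq Zcomp Za.
exists p; split=> // u Zu; rewrite Fskew oppr_ge0 -(pmulr_rle0 _ eta_gt0).
(* The regret bound divided by the number of averaged terms; its right-hand side tends to 0. *)
have bnd k : eta * dotv (F u) (a (s k)) <= lyapunov u 0 * harmonic (s k).
  rewrite /harmonic ler_pdivlMr ?ltr0n //.
  by have := regret u (s k) Zu; have := lyapunov_ge0 (s k).+1 Zu; lra.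
rewrite -(mulr0 (lyapunov u 0)).
apply: (@ler_cvg_to _ \oo _ _ (fun k => eta * dotv (F u) (a (s k)))
    (fun k => lyapunov u 0 * harmonic (s k))).
- apply: cvgMl_tmp; apply: cvg_dotv ap; exact: cvg_cst.
- by apply: cvgMl_tmp; apply: cvg_along cvg_harmonic.
- exact: nearW.
Qed.

Lemma lyapunov_descent p : vi_solution p ->
  cvgn (lyapunov p) /\
  5 / 16 * sq (w k.+1 - z k.+1) + 3 / 8 * sq (z k.+1 - w k) @[k --> \oo] --> 0.
Proof.
move=> [Zp pvi]; apply: descent_cvg => k.
- exact: lyapunov_ge0.
- by rewrite addr_ge0 ?mulr_ge0 ?dotv_ge0.
- apply: le_trans (lyapunov_step k Zp) _.
  by rewrite gerBl mulr_ge0 ?(ltW eta_gt0) //; exact: pvi (Zz k.+1).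
Qed.

(** The gaps do not mention [p], so any one solution suffices. Each squared gap is at most the
    vanishing sum times the inverse of its coefficient, 8/3 or 16/5. *)
Lemma optimistic_gaps :
  z k.+1 - w k @[k --> \oo] --> (0 : 'cV[R]_n) /\
  w k - z k @[k --> \oo] --> (0 : 'cV[R]_n).
Proof.
have [p /lyapunov_descent[_ gap0]] := vi_solution_exists.
split.
  apply: cvg0_dotv.
  apply: (squeeze_cvgr _ (cvg_cst 0) (_ : _ --> 0)); last first.
    rewrite -(mulr0 (8 / 3)); apply: cvgMl_tmp gap0.
  apply: nearW => k; have := dotv_ge0 (w k.+1 - z k.+1).
  by have := dotv_ge0 (z k.+1 - w k) => /=; lra.
apply: cvg0_dotv; rewrite -cvg_shiftS.
apply: (squeeze_cvgr _ (cvg_cst 0) (_ : _ --> 0)); last first.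
  rewrite -(mulr0 (16 / 5)); apply: cvgMl_tmp gap0.
apply: nearW => k; have := dotv_ge0 (w k.+1 - z k.+1).
by have := dotv_ge0 (z k.+1 - w k) => /=; lra.
Qed.

(** Along the subsequence [w (s k)], [z (s k).+1] and [w (s k).+1] share the limit [p], so the
    gradient difference in the optimality condition of [w (s k).+1] vanishes and the variational
    inequality remains. *)
Lemma optimistic_limit_point :
  exists2 p, vi_solution p & exists2 s : nat -> nat,
    (forall k, (k <= s k)%N) & (w \o s) @ \oo --> p.
Proof.
have [p Zp [s sk wp]] := compact_seq Zcomp Zw.
have [zw0 wz0] := optimistic_gaps.
exists p; last by exists s.
have zp : z (s k).+1 @[k --> \oo] --> p.
  exact: cvg_sub0 (cvg_along sk zw0) wp.
have w'p : w (s k).+1 @[k --> \oo] --> p.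
  move: wz0; rewrite -cvg_shiftS => wz0.
  exact: cvg_sub0 (cvg_along sk wz0) zp.
split=> // u Zu; rewrite -(pmulr_rge0 _ eta_gt0).
have opt k := mirror_step_optimality (wmin (s k)) Zu.
have lim : eta * dotv (F (z (s k).+1)) (u - w (s k).+1) +
    dotv (g (w (s k).+1) - g (w (s k))) (u - w (s k).+1) @[k --> \oo] -->
    eta * dotv (F p) (u - p) + dotv (g p - g p) (u - p).
  apply: cvgD; first apply: cvgMl_tmp; apply: cvg_dotv.
  - exact: (skew_cvg zp).
  - by apply: cvgB w'p; exact: cvg_cst.
  - apply: cvgB; first exact: (gradient_cvg (fun k => Zw (s k).+1) Zp w'p).
    exact: (gradient_cvg (fun k => Zw (s k)) Zp wp).
  - by apply: cvgB w'p; exact: cvg_cst.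
have : 0 <= eta * dotv (F p) (u - p) + dotv (g p - g p) (u - p).
  by apply: (cvgr_to_ge lim); exact: nearW.
by rewrite !dotvE skew_diag; lra.
Qed.

Lemma optimistic_cvg : exists2 p, vi_solution p & z @ \oo --> p.
Proof.
have [p pvi [s sk wp]] := optimistic_limit_point.
have [Zp _] := pvi; have [zw0 wz0] := optimistic_gaps.
have [cV _] := lyapunov_descent pvi.
(* The bound [bregman_le] requires continuity of [g] only, not of [psi]. *)
have Ds0 : D p (w (s k)) @[k --> \oo] --> 0.
  apply: (@squeeze_cvgr _ _ _ _ (fun=> 0)
      (fun k => dotv (g p - g (w (s k))) (p - w (s k)))).
  - by apply: nearW => k; rewrite bregman_ge0 ?bregman_le //; exact: Zw.
  - exact: cvg_cst.
  - have <- : dotv (g p - g p) (p - p) = 0 by rewrite !dotvE; lra.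
    apply: cvg_dotv; apply: cvgB; [exact: cvg_cst| |exact: cvg_cst|exact: wp].
    exact: (gradient_cvg (fun k => Zw (s k)) Zp wp).
(* The whole Lyapunov sequence converges, so its limit is read off along [s]. *)
have V0 : limn (lyapunov p) = 0.
  apply: (cvg_unique _ (cvg_along sk cV)) => //.
  have <- : 0 + 8^-1 * dotv (0 : 'cV[R]_n) 0 = 0.
    by rewrite /dotv big1 ?mulr0 ?addr0 // => i _; rewrite mxE mul0r.
  apply: cvgD => //; apply: cvgMl_tmp.
  by have wzs := cvg_along sk wz0; exact: cvg_dotv.
rewrite V0 in cV.
have wp0 : w k - p @[k --> \oo] --> (0 : 'cV[R]_n).
  apply: cvg0_dotv.
  (* Strong convexity bounds [sq (w k - p)] by twice the Lyapunov value. *)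
  apply: (squeeze_cvgr _ (cvg_cst 0) (_ : _ --> 0)); last first.
    rewrite -(mulr0 2); apply: cvgMl_tmp cV.
  apply: nearW => k; have := dotv_ge0 (w k - z k).
  have := bregman_ge Zp (Zw k); have := dotv_ge0 (w k - p).
  by rewrite -[w k - p]opprB dotvNl dotvNr opprK /= /lyapunov; lra.
exists p => //; rewrite -cvg_shiftS.
by apply: cvg_sub0 zw0 _; exact: cvg_zero wp0.
Qed.

End MirrorDescent.

(** * The game operator *)

Lemma dotv_col_mx (R : realType) m n (a : 'cV[R]_m) (b : 'cV[R]_n) z :
  dotv (col_mx a b) z = dotv a (usubmx z) + dotv b (dsubmx z).
Proof.
rewrite /dotv big_split_ord; congr (_ + _); apply: eq_bigr => i _.
  by rewrite col_mxEu mxE.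
by rewrite col_mxEd mxE.
Qed.

Lemma dotv_split (R : realType) m n (u v : 'cV[R]_(m + n)) :
  dotv u v = dotv (usubmx u) (usubmx v) + dotv (dsubmx u) (dsubmx v).
Proof. by rewrite -{1}[u]vsubmxK dotv_col_mx. Qed.

Section JointSet.
Variables (R : realType) (M N : nat) (X : set 'cV[R]_M) (Y : set 'cV[R]_N).

Lemma joint_set_convex :
  convex_subset X -> convex_subset Y -> convex_subset (joint_set X Y).
Proof.
move=> Xc Yc u v s [Xu Yu] [Xv Yv] s01.
by split; rewrite linearD linearZ linearB /=; [exact: Xc | exact: Yc].
Qed.

Lemma joint_set_compact : compact X -> compact Y -> compact (joint_set X Y).
Proof.
move=> Xc Yc.
rewrite (_ : joint_set X Y =
    (fun xy : 'cV[R]_M * 'cV[R]_N => col_mx xy.1 xy.2) @` (X `*` Y)).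
  apply: continuous_compact (compact_setX Xc Yc); apply: continuous_subspaceT.
  by apply: continuous_col_mx => x; [exact: cvg_fst | exact: cvg_snd].
apply/seteqP; split=> [z [Xz Yz]|_ [[x y] [/= Xx Yy] <-]].
  by exists (usubmx z, dsubmx z) => //=; exact: vsubmxK.
by rewrite /joint_set /= col_mxKu col_mxKd.
Qed.

End JointSet.

Section Operator.
Variables (R : realType) (M N : nat) (G : 'M[R]_(M, N)).
Implicit Types (u v : 'cV[R]_(M + N)).

Lemma dotv_trmx_mul (x : 'cV[R]_M) (y : 'cV[R]_N) :
  dotv (G^T *m x) y = payoff G x y.
Proof.
rewrite /payoff /dotv; under eq_bigr do rewrite mxE mulr_suml.
rewrite exchange_big; apply: eq_bigr => i _; rewrite mxE mulr_sumr.
by apply: eq_bigr => j _; rewrite mxE; ring.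
Qed.

Lemma dotv_operatorF u v : dotv (operatorF G u) v =
  payoff G (usubmx v) (dsubmx u) - payoff G (usubmx u) (dsubmx v).
Proof. by rewrite dotv_col_mx dotvNl dotv_trmx_mul dotvC. Qed.

Lemma operatorF_sub : {morph operatorF G : u v / u - v}.
Proof.
move=> u v.
rewrite /operatorF opp_col_mx add_col_mx [usubmx _]linearB [dsubmx _]linearB /=.
by rewrite !mulmxBr opprD.
Qed.

Lemma operatorF_skew u v : dotv (operatorF G u) v = - dotv (operatorF G v) u.
Proof. by rewrite !dotv_operatorF opprB. Qed.

Hypothesis hG : forall i j, -1 <= G i j <= 1.

(** Entrywise, |x_i G_ij y_j| is at most (x_i^2 + y_j^2)/2; the double sum repeats each x_i^2 [N]
    times and each y_j^2 [M] times. *)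
Lemma payoff_norm_le (x : 'cV[R]_M) (y : 'cV[R]_N) :
  `|payoff G x y| <= 2^-1 * (N%:R * dotv x x + M%:R * dotv y y).
Proof.
have -> : 2^-1 * (N%:R * dotv x x + M%:R * dotv y y) =
    \sum_i \sum_j 2^-1 * (x i 0 * x i 0 + y j 0 * y j 0).
  under eq_bigr => i _ do
    rewrite -mulr_sumr big_split /= sumr_const card_ord -[_ *+ N]mulr_natl.
  rewrite -mulr_sumr big_split /= -mulr_sumr sumr_const card_ord.
  by rewrite [M%:R * _]mulr_natl.
apply: le_trans (ler_norm_sum _ _ _) _; apply: ler_sum => i _.
rewrite mxE mulr_sumr.
apply: le_trans (ler_norm_sum _ _ _) _; apply: ler_sum => j _.
have G1 : `|G i j| <= 1 by rewrite ler_norml.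
rewrite !normrM -[x i 0 * _]expr2 -[y j 0 * _]expr2.
rewrite -(real_normK (num_real (x i 0))) -(real_normK (num_real (y j 0))).
have := normr_ge0 (x i 0); have := normr_ge0 (y j 0).
move: `|x i 0| `|y j 0| => a b b0 a0.
have : a * (`|G i j| * b) <= a * b by rewrite ler_wpM2l // ler_piMl.
by have := sqr_ge0 (a - b); lra.
Qed.

(** The two payoffs in [dotv_operatorF] total at most P/2 times [dotv u u + dotv v v], where P = M +
    N, and eta P is at most 1/8. *)
Lemma operatorF_bound (eta : R) u v : 0 < eta <= 1 / (8 * (M + N)%:R) ->
  eta * dotv (operatorF G u) v <= 16^-1 * (dotv u u + dotv v v).
Proof.
move=> /andP[eta0 etaP].
have P0 : 0 < (M + N)%:R :> R.
  (* Division by 0 yields 0, so P = 0 would contradict [0 < eta]. *)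
  rewrite lt_neqAle ler0n andbT eq_sym; apply/eqP => P0.
  by move: etaP; rewrite P0 mulr0 invr0 mulr0 leNgt eta0.
have etaP' : eta * (M + N)%:R <= 8^-1.
  by move: etaP; rewrite ler_pdivlMr ?mulr_gt0 //; lra.
have bound : dotv (operatorF G u) v <=
    2^-1 * ((M + N)%:R * (dotv u u + dotv v v)).
  rewrite dotv_operatorF !dotv_split natrD.
  have := payoff_norm_le (usubmx v) (dsubmx u).
  have := payoff_norm_le (usubmx u) (dsubmx v).
  rewrite !ler_norml => /andP[+ _] /andP[_].
  have m0 : 0 <= M%:R :> R by [].
  have n0 : 0 <= N%:R :> R by [].
  have := mulr_ge0 m0 (dotv_ge0 (usubmx u)).
  have := mulr_ge0 m0 (dotv_ge0 (usubmx v)).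
  have := mulr_ge0 n0 (dotv_ge0 (dsubmx u)).
  have := mulr_ge0 n0 (dotv_ge0 (dsubmx v)).
  lra.
apply: le_trans (ler_wpM2l (ltW eta0) bound) _.
rewrite mulrCA [eta * _]mulrA.
have s0 : 0 <= dotv u u + dotv v v by rewrite addr_ge0 ?dotv_ge0.
by have := ler_wpM2r s0 etaP'; lra.
Qed.

(** Boundedness makes the [sup] and [inf] in the definition of equilibria genuine bounds. *)
Lemma payoff_norm_le_box (x : 'cV[R]_M) (y : 'cV[R]_N) :
  (forall i, 0 <= x i 0 <= 1) -> (forall j, 0 <= y j 0 <= 1) ->
  `|payoff G x y| <= (M * N)%:R.
Proof.
have box_sq k (a : 'cV[R]_k) : (forall i, 0 <= a i 0 <= 1) -> dotv a a <= k%:R.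
  move=> a01; rewrite -[k in k%:R]card_ord -sumr_const; apply: ler_sum => i _.
  by have /andP[a0 a1] := a01 i; exact: mulr_ile1.
move=> /box_sq x1 /box_sq y1; apply: le_trans (payoff_norm_le x y) _.
have := ler_wpM2l (ler0n R N) x1; have := ler_wpM2l (ler0n R M) y1.
by rewrite natrM; lra.
Qed.

(** * From the variational inequality to Nash equilibria *)

Variables (X : set 'cV[R]_M) (Y : set 'cV[R]_N).
Hypotheses (tX : treeplex X) (tY : treeplex Y).

(** Tested at [col_mx x y], the inequality is the saddle condition. Hence the worst payoff of
    [usubmx p] is at most [payoff G x (dsubmx p)], which is at most the worst payoff of [x]; the
    other player is symmetric. *)
Lemma vi_solution_nash p : vi_solution (joint_set X Y) (operatorF G) p ->
  nash X Y G p.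
Proof.
move=> [[Xp Yp] pvi].
have saddle x y : X x -> Y y ->
    payoff G (usubmx p) y <= payoff G x (dsubmx p).
  move=> Xx Yy; have := pvi (col_mx x y).
  rewrite dotv_operatorF /joint_set /= col_mxKu col_mxKd subr_ge0; exact.
have payoff_bnd x y : X x -> Y y -> `|payoff G x y| <= (M * N)%:R.
  by move=> /(treeplex_unit_box tX) x1 /(treeplex_unit_box tY);
    exact: payoff_norm_le_box.
split; split=> //; [move=> x Xx | move=> y Yy].
- apply: ge_sup => [|_ [y Yy <-]].
    by have [y Yy] := treeplex_nonempty tY; exists (payoff G (usubmx p) y), y.
  apply: le_trans (saddle _ _ Xx Yy) _; apply: ub_le_sup; last by exists (dsubmx p).
  exists (M * N)%:R => _ [y' Yy' <-].
  by have := payoff_bnd _ _ Xx Yy'; rewrite ler_norml => /andP[].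
- apply: lb_le_inf => [|_ [x Xx <-]].
    by have [x Xx] := treeplex_nonempty tX; exists (payoff G x (dsubmx p)), x.
  apply: le_trans (saddle _ _ Xx Yy); apply: ge_inf; last by exists (usubmx p).
  exists (- (M * N)%:R) => _ [x' Xx' <-].
  by have := payoff_bnd _ _ Xx' Yy; rewrite ler_norml => /andP[].
Qed.

End Operator.

Theorem theorem4 (R : realType) (M N : nat)
  (X : set 'cV[R]_M) (Y : set 'cV[R]_N) (G : 'M[R]_(M, N))
  (hX : treeplex X) (hY : treeplex Y)
  (hG : forall i j, -1 <= G i j <= 1)
  (hF : forall z, joint_set X Y z -> `|operatorF G z| <= 1)
  (psiX : 'cV[R]_M -> R) (psiY : 'cV[R]_N -> R)
  (grad : 'cV[R]_(M + N) -> 'cV[R]_(M + N))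
  (hpsiX : convex_function X psiX) (hpsiY : convex_function Y psiY)
  (hC1 : continuously_differentiable_on (joint_set X Y)
           (joint_fun psiX psiY) grad)
  (hsc : strongly_convex1 (joint_set X Y) (joint_fun psiX psiY) grad)
  (eta : R) (heta : 0 < eta <= 1 / (8 * (M + N)%:R))
  (z zhat : nat -> 'cV[R]_(M + N))
  (hz : oomd (joint_set X Y) (operatorF G) (joint_fun psiX psiY) grad eta
          z zhat) :
  exists2 zinf : 'cV[R]_(M + N), nash X Y G zinf & z @ \oo --> zinf.
Proof.
have [z0 zhat1 steps] := hz; have [_ gcont] := hC1.
(* With [w k] taken as [zhat k.+1], abstract step [k] is round [k.+1] of the algorithm. *)
have [p pvi zp] := optimistic_cvg
  (joint_set_convex (treeplex_convex hX) (treeplex_convex hY))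
  (joint_set_compact (treeplex_compact hX) (treeplex_compact hY))
  gcont hsc (proj1 (andP heta)) (@operatorF_sub R M N G) (@operatorF_skew R M N G)
  (fun u v => operatorF_bound hG u v heta)
  z0 (zhat1 : (fun k => zhat k.+1) 0%N = z 0%N)
  (fun k => (steps k.+1 isT).1) (fun k => (steps k.+1 isT).2).
by exists p => //; exact: vi_solution_nash pvi.
Qed.
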